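(* Let $\kappa\in(0,1)$, $q\in[0,1]$, $w>0$, and let $\mu$ be a finite Borel measure on $[0,1]$ with a continuous, everywhere positive density. A pure-strategy Nash equilibrium exists if and only if $\kappa>0.5$. When an equilibrium exists, it is unique, in the sense that if $(f^\star,a^\star)$ and $(f^\diamond,a^\diamond)$ are pure-strategy Nash equilibria, then $f^\star=f^\diamond$ $\mu$-almost surely and $a^\star=a^\diamond$.
   Context: Fix parameters $\kappa\in(0,1)$, $w>0$, $q\in[0,1]$, and a finite Borel measure $\mu$ on $[0,1]$ with a continuous, everywhere positive density (with respect to Lebesgue measure). A feasible strategy profile is a pair $(f,a)$ where $f=(f_1,f_2):[0,1]\to\{(x_1,x_2)\in\mathbb{R}^2: x_1,x_2\ge 0,\ x_1+x_2\le 1\}$ is measurable (strategy profile for the diffuse players, indexed by their belief $p$ about the probability of Outcome 1) and $a=(a_1,a_2)\in\mathbb{R}^2$ with $a_1,a_2\ge 0$ and $a_1+a_2\le w$ (strategy profile for the atomic player, who believes that Outcome 1 has probability $q$). For a feasible strategy profile, $d_i=\int_0^1 f_i(p)\,\mu(dp)$ for $i=1,2$ (and $d_i^\star$ denotes this for $f^\star$). If at least one of $d_1,d_2,a_1,a_2$ is positive, the implied probability of Outcome 1 is $$P^{f,a}=\frac{d_1+a_1}{d_1+a_1+d_2+a_2}.$$ Convention: in expressions such as $\frac{\kappa\,\mathbf{1}_{\{P\ne 0\}}\,p}{P}$ and $\frac{\kappa\,\mathbf{1}_{\{P\ne 1\}}(1-p)}{1-P}$, the fraction is taken to be $0$ when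 the indicator is $0$. A pure-strategy Nash equilibrium is a feasible strategy profile $(f^\star,a^\star)$ such that: (i) at least one of $d_1^\star,d_2^\star,a_1^\star,a_2^\star$ is positive; (ii) for every $p\in[0,1]$, writing $P=P^{f^\star,a^\star}$, $$f_1^\star(p)\left(\frac{\kappa\mathbf{1}_{\{P\ne 0\}}p}{P}-1\right)+f_2^\star(p)\left(\frac{\kappa\mathbf{1}_{\{P\ne 1\}}(1-p)}{1-P}-1\right)=\sup_{\substack{b_1,b_2\ge 0\\ b_1+b_2\le 1}}\left\{b_1\left(\frac{\kappa\mathbf{1}_{\{P\ne 0\}}p}{P}-1\right)+b_2\left(\frac{\kappa\mathbf{1}_{\{P\ne 1\}}(1-p)}{1-P}-1\right)\right\};$$ (iii) with $P=P^{f^\star,a^\star}$ and, for $b=(b_1,b_2)$, $P^b=P^{f^\star,b}=\frac{d_1^\star+b_1}{d_1^\star+b_1+d_2^\star+b_2}$, $$a_1^\star\left(\frac{\kappa\mathbf{1}_{\{P\ne 0\}}q}{P}-1\right)+a_2^\star\left(\frac{\kappa\mathbf{1}_{\{P\ne 1\}}(1-q)}{1-P}-1\right)=\sup_{b}\left\{b_1\left(\frac{\kappa\mathbf{1}_{\{P^b\ne 0\}}q}{P^b}-1\right)+b_2\left(\frac{\kappa\mathbf{1}_{\{P^b\ne 1\}}(1-q)}{1-P^b}-1\right)\right\},$$ where the supremum is over $b_1,b_2\ge 0$ with $b_1+b_2\le w$ such that at least one of $d_1^\star,d_2^\star,b_1,b_2$ is positive. *)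

(* Defs.v *)
From mathcomp Require Import all_boot all_order all_algebra.
From mathcomp Require Import all_classical all_reals all_analysis.
Import Order.TTheory GRing.Theory Num.Theory.
Import numFieldNormedType.Exports.

Set Implicit Arguments.
Unset Strict Implicit.
Unset Printing Implicit Defensive.

Local Open Scope classical_set_scope.
Local Open Scope ring_scope.

Section Wagering.
Context {R : realType}.

(* A Borel measure on [0,1] is represented by its extension by zero to the
   Borel sets of R; the integral formula also makes it vanish off [0,1]. *)
Definition has_continuous_positive_density
    (mu : {measure set (measurableTypeR R) -> \bar R}) : Prop :=
  exists rho : R -> R,
    [/\ {within `[0, 1], continuous rho},
        forall x, x \in `[0, 1] -> 0 < rho x
      & forall A : set (measurableTypeR R), measurable A ->
          mu A = (\int[lebesgue_measure]_(x in A `&` `[0%R, 1%R]) (rho x)%:E)%E].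

Definition bets (c : R) : set (R * R) :=
  [set b | [/\ 0 <= b.1, 0 <= b.2 & b.1 + b.2 <= c]].

(* The diffuse strategy f : [0,1] -> R^2 is a function on R whose values
   outside [0,1] are irrelevant. *)
Definition feasible (w : R) (f : R -> R * R) (a : R * R) : Prop :=
  [/\ measurable_fun (`[0, 1] : set (measurableTypeR R)) f,
      forall p, p \in `[0, 1] -> bets 1 (f p)
    & bets w a].

Definition diffuse_total (mu : {measure set (measurableTypeR R) -> \bar R})
    (f : R -> R * R) : R * R :=
  (\int[mu]_(p in `[0, 1]) (f p).1, \int[mu]_(p in `[0, 1]) (f p).2).

Definition some_wager (d a : R * R) : Prop :=
  [\/ 0 < d.1, 0 < d.2, 0 < a.1 | 0 < a.2].

Definition implied_prob (d a : R * R) : R :=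
  (d.1 + a.1) / (d.1 + a.1 + d.2 + a.2).

(* Expected profit from the bets b, at implied probability P, for a player who
   believes that Outcome 1 has probability r; as x / 0 = 0, each fraction
   vanishes when its indicator does. *)
Definition profit (kappa P r : R) (b : R * R) : R :=
  b.1 * (kappa * (P != 0)%:R * r / P - 1) +
  b.2 * (kappa * (P != 1)%:R * (1 - r) / (1 - P) - 1).

(* The suprema are taken in the extended reals, so that the equalities below
   have their usual meaning without a prior proof of boundedness. *)
Definition nash_equilibrium (kappa w q : R)
    (mu : {measure set (measurableTypeR R) -> \bar R})
    (f : R -> R * R) (a : R * R) : Prop :=
  let d := diffuse_total mu f in
  let P := implied_prob d a in
  [/\ feasible w f a,
      some_wager d a,
      forall p, p \in `[0, 1] ->
        (profit kappa P p (f p))%:E =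
          ereal_sup [set (profit kappa P p b)%:E | b in bets 1]
    & (profit kappa P q a)%:E =
        ereal_sup [set (profit kappa (implied_prob d b) q b)%:E
                  | b in [set b | bets w b /\ some_wager d b]]].

End Wagering.

(* Main.v *)
Require Import Defs.
From mathcomp Require Import all_boot all_order all_algebra.
From mathcomp Require Import all_classical all_reals all_analysis.
From mathcomp Require Import measurable_realfun ring lra.
Import Order.TTheory GRing.Theory Num.Theory.
Import numFieldNormedType.Exports.

(** Suppose first that the price [P] of Outcome 1 lies strictly between 0 and 1.
    A diffuse player with belief [p] stakes everything on Outcome 1 when
    [kappa * p > P], everything on Outcome 2 when [kappa * (1 - p) > 1 - P], and
    nothing otherwise; the first two cases exclude each other since
    [kappa < 1].  The measure has no atoms, so ties are negligible and the price
    determines both [f] almost everywhere and the totals [(d1, d2)]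
    ([diffuse_demand]).  As [P] grows, [d1] decreases and [d2] increases,
    continuously.

    The prices 0 and 1 never occur.  At such a price every diffuse player
    abstains, while the atomic player has no best response with a positive bet
    on an outcome that nobody else backs: half the bet keeps the whole share of
    the payout ([best_response_uncontested]).  The same remark shows that
    [d1] and [d2] are positive in an equilibrium ([nash_wagered]).  Positivity of
    [d1] means [P < kappa] and positivity of [d2] means [1 - P < kappa]; adding
    the two gives [kappa > 1/2].

    For fixed [d1, d2 > 0], write [al = kappa * q], [be = kappa * (1 - q)], and
    let [x], [y] be the total wagers on the two outcomes.  Up to a constant the
    atomic player minimizes
    [(1 - al - be) * (x + y) + al * d1 * y / x + be * d2 * x / y].
    This is not jointly convex, but for given odds [x / y] it increases with the
    size of the pool, so an optimal bet backs at most one outcome, and what is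
    left is a convex problem in one variable.  Best responses are therefore
    characterized by marginal conditions ([first_order],
    [best_response_first_order], [first_order_best_response]).

    Uniqueness: these conditions imply that the odds after the atomic player's
    response are monotone, in that more on Outcome 1 and less on Outcome 2 from
    the diffuse players never lowers them ([odds_monotone]).  If [P < P'] were two
    equilibrium prices, the diffuse wagers would move against Outcome 1 from [P]
    to [P'], so the odds could not increase, which contradicts [P < P'].  Price
    and diffuse totals determine the one-sided atomic bet.

    Existence for [kappa > 1/2]: the sign of a continuous function
    ([price_excess]) tells whether [P] is above or below the price resulting
    from the responses to [P].  It is negative at [1 - kappa] and positive at
    [kappa], and at a zero in between the marginal conditions hold. *)

Local Open Scope classical_set_scope.
Local Open Scope ring_scope.

Set Implicit Arguments.
Unset Strict Implicit.
Unset Printing Implicit Defensive.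

(** * The best responses of the atomic player *)

Section Atomic.
Context {K : realFieldType}.
Implicit Types al be w d e a b x y z k m u P : K.

(** Expected profit of the atomic player against the diffuse totals [d1] and [d2],
    for stakes [al = kappa * q] and [be = kappa * (1 - q)].  Since x / 0 = 0, an
    outcome on which nobody wagers returns nothing. *)
Definition atomic_gain al be d1 d2 b1 b2 : K :=
  (al * (b1 / (d1 + b1)) + be * (b2 / (d2 + b2))) * (d1 + b1 + d2 + b2)
  - b1 - b2.

Definition best_response al be w d1 d2 a1 a2 : Prop :=
  [/\ 0 <= a1, 0 <= a2, a1 + a2 <= w &
      forall b1 b2, 0 <= b1 -> 0 <= b2 -> b1 + b2 <= w ->
        0 < d1 + b1 + d2 + b2 ->
        atomic_gain al be d1 d2 b1 b2 <= atomic_gain al be d1 d2 a1 a2].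

Lemma atomic_gainC al be d1 d2 b1 b2 :
  atomic_gain al be d1 d2 b1 b2 = atomic_gain be al d2 d1 b2 b1.
Proof. by rewrite /atomic_gain; ring. Qed.

Lemma best_responseC al be w d1 d2 a1 a2 :
  best_response al be w d1 d2 a1 a2 -> best_response be al w d2 d1 a2 a1.
Proof.
move=> [a10 a20 aw opt]; split=> // [|b1 b2 b10 b20 bw b_gt0]; first lra.
rewrite -2!(atomic_gainC al be); apply: opt => //; lra.
Qed.

(** Being alone on an outcome secures its whole payout share at any positive
    bet, so halving such a bet gives up at most the fraction [al + be < 1] of what
    it saves. *)
Lemma best_response_uncontested al be w d2 a1 a2 :
  0 <= al -> 0 <= be -> al + be < 1 -> 0 <= d2 ->
  best_response al be w 0 d2 a1 a2 -> a1 = 0.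
Proof.
move=> al0 be0 albe d20 [a10 a20 aw opt].
apply/eqP; rewrite eq_le a10 andbT leNgt; apply/negP => a1_gt0.
have h_gt0 : 0 < a1 / 2 by lra.
have := opt (a1 / 2) a2 (ltW h_gt0) a20.
rewrite /atomic_gain !add0r !divff; [|lra..].
set s := a2 / (d2 + a2).
have s1 : s <= 1.
  rewrite /s; have [->|?] := eqVneq (d2 + a2) 0; first by rewrite invr0; lra.
  rewrite ler_pdivrMr; lra.
have : be * s <= be by rewrite ler_piMr.
by move=> ? opt'; have : a1 / 2 + a2 <= w by [lra]; nra.
Qed.

(** The quantity that the atomic player minimizes, as a function of the total
    wagers [x] and [y]: its last two terms depend on the odds [x / y] only, and
    its first term on the size of the pool only. *)
Definition atomic_cost al be d1 d2 x y : K :=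
  (1 - al - be) * (x + y) + al * d1 * (y / x) + be * d2 * (x / y).

Lemma atomic_gainE al be d1 d2 b1 b2 : d1 + b1 != 0 -> d2 + b2 != 0 ->
  atomic_gain al be d1 d2 b1 b2 =
  (1 - al) * d1 + (1 - be) * d2 - atomic_cost al be d1 d2 (d1 + b1) (d2 + b2).
Proof. by move=> ? ?; rewrite /atomic_gain /atomic_cost; field; apply/andP. Qed.

Lemma atomic_costC al be d1 d2 x y :
  atomic_cost al be d1 d2 x y = atomic_cost be al d2 d1 y x.
Proof. by rewrite /atomic_cost; ring. Qed.

Lemma atomic_cost_scale al be d1 d2 x y k : k != 0 ->
  atomic_cost al be d1 d2 (k * x) (k * y) =
  atomic_cost al be d1 d2 x y - (1 - k) * (1 - al - be) * (x + y).
Proof. by move=> k0; rewrite /atomic_cost -!mulf_div divff //; ring. Qed.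

Lemma atomic_costB al be d1 d2 x z : d2 != 0 -> x != 0 -> z != 0 ->
  atomic_cost al be d1 d2 z d2 - atomic_cost al be d1 d2 x d2 =
  (x - z) * (al * d1 * d2 - (1 - al) * x * z) / (x * z).
Proof.
by move=> ? ? ?; rewrite /atomic_cost; field; do !(apply/andP; split).
Qed.

(** Passing to total wagers turns the problem into a minimization over the
    triangle [d1 <= x], [d2 <= y], [x + y <= d1 + d2 + w]. *)
Lemma best_responseP al be w d1 d2 a1 a2 : 0 < d1 -> 0 < d2 ->
  best_response al be w d1 d2 a1 a2 <->
  [/\ 0 <= a1, 0 <= a2, a1 + a2 <= w &
      forall x y, d1 <= x -> d2 <= y -> x + y <= d1 + d2 + w ->
        atomic_cost al be d1 d2 (d1 + a1) (d2 + a2)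
        <= atomic_cost al be d1 d2 x y].
Proof.
move=> d1_gt0 d2_gt0; split=> -[a10 a20 aw opt]; split=> //.
  move=> x y d1x d2y xyw; have := opt (x - d1) (y - d2).
  rewrite !atomic_gainE; try (apply: lt0r_neq0; lra).
  by rewrite !subrKC => {}opt; lra.
move=> b1 b2 b10 b20 bw _; rewrite !atomic_gainE; try (apply: lt0r_neq0; lra).
by have := opt (d1 + b1) (d2 + b2); lra.
Qed.

(** Shrinking both totals by the same factor keeps the odds and lowers the
    cost, and this is feasible as long as both outcomes are backed. *)
Lemma best_response_one_sided al be w d1 d2 a1 a2 :
  al + be < 1 -> 0 < d1 -> 0 < d2 ->
  best_response al be w d1 d2 a1 a2 -> 0 < a1 -> a2 = 0.
Proof.
move=> albe d1_gt0 d2_gt0 /best_responseP[] // a10 a20 aw opt a1_gt0.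
apply/eqP; rewrite eq_le a20 andbT leNgt; apply/negP => a2_gt0.
set x := d1 + a1 in opt; set y := d2 + a2 in opt.
have x_gt0 : 0 < x by rewrite /x; lra.
have y_gt0 : 0 < y by rewrite /y; lra.
(* The largest relative reduction that keeps both bets nonnegative. *)
pose e := Num.min (a1 / x) (a2 / y).
have e_gt0 : 0 < e by rewrite lt_min !divr_gt0.
have ex : e * x <= a1 by rewrite -ler_pdivlMr // ge_min lexx.
have ey : e * y <= a2 by rewrite -ler_pdivlMr // ge_min lexx orbT.
have e_lt1 : e < 1 by rewrite gt_min ltr_pdivrMr // mul1r /x; lra.
have exy : 0 < e * (x + y) by rewrite mulr_gt0 // addr_gt0.
have := opt ((1 - e) * x) ((1 - e) * y).
rewrite atomic_cost_scale; last by lra.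
have : 0 < (1 - (1 - e)) * (1 - al - be) * (x + y).
  by rewrite !mulr_gt0 //; lra.
by rewrite /x /y in ex ey exy *; nra.
Qed.

Lemma ler_limit_left k m l x : 0 <= k -> l < x ->
  (forall z, l <= z < x -> k * z <= m) -> k * x <= m.
Proof.
move=> k0 lx H; apply/ler_addgt0Pr => e e_gt0.
have k1 : 0 < k + 1 by lra.
(* The added 1 covers the case k = 0. *)
pose h := Num.min (x - l) (e / (k + 1)).
have h_gt0 : 0 < h by rewrite lt_min divr_gt0 // subr_gt0 lx.
have hl : h <= x - l by rewrite ge_min lexx.
have : h * (k + 1) <= e by rewrite -ler_pdivlMr // ge_min lexx orbT.
have : l <= x - h < x by lra.
by move=> /H; lra.
Qed.

Lemma ler_limit_right k m u x : 0 <= k -> x < u ->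
  (forall z, x < z <= u -> m <= k * z) -> m <= k * x.
Proof.
move=> k0 xu H; have : k * - x <= - m; last lra.
apply: (@ler_limit_left _ _ (- u)) => // [|z zux]; first lra.
by have : x < - z <= u by [lra]; move=> /H; lra.
Qed.

(** With [x = d1 + a1] and the second outcome not backed, the derivative of the
    gain in [a1] has the sign of [al * d1 * d2 - (1 - al) * x ^+ 2].  It may not be
    negative where the bet can decrease, nor positive where it can increase.
    The conditions for the second outcome are obtained by exchanging the roles. *)
Definition first_order al w d1 d2 a1 a2 : Prop :=
  (0 < a1 -> a2 = 0 /\ (1 - al) * (d1 + a1) ^+ 2 <= al * d1 * d2) /\
  (a2 = 0 -> a1 < w -> al * d1 * d2 <= (1 - al) * (d1 + a1) ^+ 2).

(** Comparing with nearby bets on the same outcome gives a product inequality in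
    [x] and a neighbour [z]; letting [z] tend to [x] gives the squares. *)
Lemma best_response_first_order al be w d1 d2 a1 a2 :
  al <= 1 -> al + be < 1 -> 0 < d1 -> 0 < d2 ->
  best_response al be w d1 d2 a1 a2 -> first_order al w d1 d2 a1 a2.
Proof.
move=> al1 albe d1_gt0 d2_gt0 br.
have one_sided := @best_response_one_sided _ _ _ _ _ _ _ albe d1_gt0 d2_gt0 br.
move: br => /best_responseP[]// a10 a20 aw opt.
have slope z : a2 = 0 -> d1 <= z -> z <= d1 + w ->
    0 <= (d1 + a1 - z) * (al * d1 * d2 - (1 - al) * (d1 + a1) * z).
  move=> a2E d1z zw; rewrite a2E addr0 in opt.
  have : atomic_cost al be d1 d2 (d1 + a1) d2 <= atomic_cost al be d1 d2 z d2.
    by apply: opt => //; lra.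
  rewrite -subr_ge0 atomic_costB; try (apply: lt0r_neq0; lra).
  by rewrite pmulr_lge0 // invr_gt0 mulr_gt0 //; lra.
have k0 : 0 <= (1 - al) * (d1 + a1) by rewrite mulr_ge0; lra.
split=> [a1_gt0|a2E a1w]; rewrite expr2 mulrA.
  have a2E := one_sided a1_gt0; split=> //.
  apply: (@ler_limit_left _ _ d1) => // [|z /andP[d1z zx]]; first lra.
  have : 0 < d1 + a1 - z by lra.
  by move=> h; have := slope z a2E; rewrite (pmulr_rge0 _ h); lra.
apply: (@ler_limit_right _ _ (d1 + w)) => // [|z /andP[xz zw]]; first lra.
have h : d1 + a1 - z < 0 by lra.
by have := slope z a2E; rewrite (nmulr_rge0 _ h); lra.
Qed.

(** Sliding towards the origin along the ray of constant odds until the second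
    total is [d2] only reduces the pool. *)
Lemma atomic_cost_ray al be d1 d2 x y : al + be < 1 -> 0 < d2 ->
  0 < x -> d2 <= y ->
  atomic_cost al be d1 d2 (d2 / y * x) d2 <= atomic_cost al be d1 d2 x y.
Proof.
move=> albe d2_gt0 x_gt0 d2y; have y_gt0 : 0 < y by lra.
have {3}-> : d2 = d2 / y * y by rewrite divfK ?gt_eqF.
have k_gt0 : 0 < d2 / y by rewrite divr_gt0.
rewrite atomic_cost_scale ?gt_eqF // gerBl !mulr_ge0 //; try lra.
by rewrite subr_ge0 ler_pdivrMr // mul1r.
Qed.

(** On the edge where the second outcome is not backed the cost is a convex
    function of the first total, so one-sided slopes decide whether [x] beats [z]. *)
Lemma atomic_cost_min al be d1 d2 x z : 0 < d2 -> 0 < x -> 0 < z -> al <= 1 ->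
  (z < x -> (1 - al) * x ^+ 2 <= al * d1 * d2) ->
  (x < z -> al * d1 * d2 <= (1 - al) * x ^+ 2) ->
  atomic_cost al be d1 d2 x d2 <= atomic_cost al be d1 d2 z d2.
Proof.
move=> d2_gt0 x_gt0 z_gt0 al1 left right.
rewrite -subr_ge0 atomic_costB ?gt_eqF // pmulr_lge0 ?invr_gt0 ?mulr_gt0 //.
have k0 : 0 <= (1 - al) * x by rewrite mulr_ge0; lra.
case: (ltgtP z x) => [zx|xz|->]; last by rewrite subrr mul0r.
- apply: mulr_ge0; [lra|]; move: (left zx); rewrite expr2 mulrA.
  by have := ler_wpM2l k0 (ltW zx); lra.
apply: mulr_le0; [lra|]; move: (right xz); rewrite expr2 mulrA.
by have := ler_wpM2l k0 (ltW xz); lra.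
Qed.

(** Every competitor is slid along its ray.  Sliding to the edge [y = d2] suffices
    if [0 < a1], because the marginal condition then also rules out all smaller
    values of [x], even those below [d1].  If [a1 = 0], odds below [d1 / d2] are
    slid to the edge [x = d1] and handled by the condition for the second outcome. *)
Lemma first_order_best_response_left al be w d1 d2 a1 :
  0 <= al -> 0 <= be -> al + be < 1 -> 0 < d1 -> 0 < d2 ->
  0 <= a1 -> a1 <= w -> 0 < w ->
  first_order al w d1 d2 a1 0 -> first_order be w d2 d1 0 a1 ->
  best_response al be w d1 d2 a1 0.
Proof.
move=> al0 be0 albe d1_gt0 d2_gt0 a10 a1w w_gt0 [fo1 fo1'] [_ fo2'].
apply/best_responseP => //; split=> //; first lra.
move=> x y d1x d2y xyw; rewrite addr0.
have x_gt0 : 0 < x by lra.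
have y_gt0 : 0 < y by lra.
pose z := d2 / y * x; have z_gt0 : 0 < z by rewrite !mulr_gt0 ?invr_gt0.
have zE : z * y = d2 * x by rewrite /z mulrAC divfK ?gt_eqF.
case: (boolP ((0 < a1) || (d1 <= z))) => [side1|].
  apply: le_trans (atomic_cost_ray d1 albe d2_gt0 x_gt0 d2y).
  have left : z < d1 + a1 -> (1 - al) * (d1 + a1) ^+ 2 <= al * d1 * d2.
    move=> zx; have a1_gt0 : 0 < a1 by case/orP: side1 => ?; lra.
    by have [] := fo1 a1_gt0.
  have right : d1 + a1 < z -> al * d1 * d2 <= (1 - al) * (d1 + a1) ^+ 2.
    move=> xz; apply: fo1' => //.
    have : z <= x by rewrite /z ler_piMl ?(ltW x_gt0) // ler_pdivrMr // mul1r.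
    by lra.
  by apply: atomic_cost_min; rewrite -/z //; lra.
rewrite negb_or -leNgt -ltNge => /andP[a1_le0 zd1].
have a1E : a1 = 0 by lra.
pose t := d1 / x * y; have t_gt0 : 0 < t by rewrite !mulr_gt0 ?invr_gt0.
have tE : t * x = d1 * y by rewrite /t mulrAC divfK ?gt_eqF.
have d2t : d2 < t by rewrite -(ltr_pM2r x_gt0) tE -zE ltr_pM2r.
rewrite a1E addr0 !(atomic_costC al).
apply: le_trans (atomic_cost_ray d2 _ d1_gt0 y_gt0 d1x); last lra.
have := fo2' a1E w_gt0; rewrite addr0 => right.
by apply: atomic_cost_min; rewrite -/t //; lra.
Qed.

Lemma first_order_best_response al be w d1 d2 a1 a2 :
  0 <= al -> 0 <= be -> al + be < 1 -> 0 < d1 -> 0 < d2 ->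
  0 <= a1 -> 0 <= a2 -> a1 + a2 <= w -> 0 < w ->
  first_order al w d1 d2 a1 a2 -> first_order be w d2 d1 a2 a1 ->
  best_response al be w d1 d2 a1 a2.
Proof.
move=> al0 be0 albe d1_gt0 d2_gt0 a10 a20 aw w_gt0 fo1 fo2.
have [a1E|a1_neq0] := eqVneq a1 0; last first.
  have a1_gt0 : 0 < a1 by lra.
  have [a2E _] := fo1.1 a1_gt0; rewrite a2E in fo1 fo2 aw *.
  by apply: first_order_best_response_left => //; lra.
apply: best_responseC; rewrite a1E in fo1 fo2 aw *.
by apply: first_order_best_response_left => //; lra.
Qed.

(** * Comparing and constructing equilibrium prices *)

(** Suppose the odds after [(d1, d2)] were the lower ones.  Since [e1 <= d1] and
    [d2 <= e2], the bet [a2] would exceed [b2]; so [a2] is positive while [b2]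
    leaves budget unspent, and their marginal conditions bound the odds in the
    wrong order. *)
Lemma odds_monotone_unbacked be w d1 d2 a1 a2 e1 e2 b2 :
  0 <= be -> be < 1 ->
  0 < d1 -> 0 < d2 -> 0 < e1 -> 0 < e2 -> e1 <= d1 -> d2 <= e2 ->
  0 <= a1 -> 0 <= a2 -> a1 + a2 <= w -> 0 <= b2 ->
  first_order be w d2 d1 a2 a1 -> first_order be w e2 e1 b2 0 ->
  e1 * (d2 + a2) <= (d1 + a1) * (e2 + b2).
Proof.
move=> be0 be1 d1_gt0 d2_gt0 e1_gt0 e2_gt0 ed1 de2 a10 a20 aw b20 [foa _] [_ fob].
rewrite leNgt; apply/negP => odds_lt.
have : e1 * (e2 + b2) < e1 * (d2 + a2).
  by apply: le_lt_trans odds_lt; rewrite ler_pM2r; lra.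
rewrite ltr_pM2l // => Yy.
have [a1E Ha] : a1 = 0 /\ (1 - be) * (d2 + a2) ^+ 2 <= be * d2 * d1.
  by apply: foa; lra.
have Hb : be * e2 * e1 <= (1 - be) * (e2 + b2) ^+ 2 by apply: fob => //; lra.
rewrite a1E addr0 in odds_lt.
have : (d1 * (e2 + b2)) ^+ 2 < (e1 * (d2 + a2)) ^+ 2.
  by rewrite ltr_pXn2r // nnegrE mulr_ge0 //; lra.
have be1' : 0 < 1 - be by lra.
rewrite -(ltr_pM2l be1') !exprMn => sq_lt.
have d1sq : 0 < d1 ^+ 2 by rewrite exprn_gt0.
have e1sq : 0 < e1 ^+ 2 by rewrite exprn_gt0.
(* Chaining the two marginal conditions through the squared odds. *)
have step1 := ler_wpM2r (ltW e1sq) Ha; have step2 := ler_wpM2r (ltW d1sq) Hb.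
have : (be * e2 * d1) * (d1 * e1) < (be * d2 * e1) * (d1 * e1) by lra.
rewrite ltr_pM2r ?mulr_gt0 // -!mulrA.
have [->|be_neq0] := eqVneq be 0; first by rewrite !mul0r ltxx.
rewrite ltr_pM2l; last by lra.
by rewrite ltNge ler_pM // ltW.
Qed.

(** The cases [b1 = 0] and [a2 = 0] mirror each other.  If both bets are positive,
    the squared odds after [(e1, e2)] are at most [al / (1 - al)] times [e1 / e2],
    those after [(d1, d2)] at least [(1 - be) / be] times [d1 / d2], and
    [al / (1 - al) < (1 - be) / be]. *)
Lemma odds_monotone al be w d1 d2 a1 a2 e1 e2 b1 b2 :
  0 <= al -> 0 <= be -> al + be < 1 ->
  0 < d1 -> 0 < d2 -> 0 < e1 -> 0 < e2 -> e1 <= d1 -> d2 <= e2 ->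
  0 <= a1 -> 0 <= a2 -> a1 + a2 <= w -> 0 <= b1 -> 0 <= b2 -> b1 + b2 <= w ->
  first_order al w d1 d2 a1 a2 -> first_order be w d2 d1 a2 a1 ->
  first_order al w e1 e2 b1 b2 -> first_order be w e2 e1 b2 b1 ->
  (e1 + b1) * (d2 + a2) <= (d1 + a1) * (e2 + b2).
Proof.
move=> al0 be0 albe d1_gt0 d2_gt0 e1_gt0 e2_gt0 ed1 de2 a10 a20 aw b10 b20 bw.
move=> foa1 foa2 fob1 fob2.
have [b1E|b1_neq0] := eqVneq b1 0.
  rewrite b1E addr0 in fob2 *.
  by apply: (@odds_monotone_unbacked be w) => //; lra.
have [a2E|a2_neq0] := eqVneq a2 0.
  rewrite a2E addr0 in foa1 *; rewrite mulrC (mulrC (d1 + a1)).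
  by apply: (@odds_monotone_unbacked al w) => //; lra.
have [b2E Hb] : b2 = 0 /\ (1 - al) * (e1 + b1) ^+ 2 <= al * e1 * e2.
  by apply: fob1.1; lra.
have [a1E Ha] : a1 = 0 /\ (1 - be) * (d2 + a2) ^+ 2 <= be * d2 * d1.
  by apply: foa2.1; lra.
rewrite b2E a1E !addr0 -(ler_pXn2r (ltn0Sn 1)) ?nnegrE ?mulr_ge0 //; try lra.
have c_gt0 : 0 < (1 - al) * (1 - be) by rewrite mulr_gt0; lra.
rewrite -(ler_pM2l c_gt0) !exprMn.
have k1 : 0 <= (1 - al) * (e1 + b1) ^+ 2 by rewrite mulr_ge0 ?exprn_ge0; lra.
have k2 : 0 <= (1 - be) * (d2 + a2) ^+ 2 by rewrite mulr_ge0 ?exprn_ge0; lra.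
have step1 := ler_pM k1 k2 Hb Ha.
have step2 : al * be * (d1 ^+ 2 * e2 ^+ 2) <=
    (1 - al) * (1 - be) * (d1 ^+ 2 * e2 ^+ 2).
  by rewrite ler_wpM2r ?mulr_ge0 ?exprn_ge0 //; lra.
have step3 : al * be * (d1 * e2) * (e1 * d2) <= al * be * (d1 * e2) * (d1 * e2).
  by rewrite ler_wpM2l ?mulr_ge0 ?ler_pM //; lra.
lra.
Qed.

(** The price fixes the ratio of the totals, so two bets can only differ by a
    move along the ray; one-sidedness leaves no room for that. *)
Lemma first_order_unique al w d1 d2 a1 a2 b1 b2 P :
  0 < P < 1 -> 0 <= a1 -> 0 <= a2 -> 0 <= b1 -> 0 <= b2 ->
  (1 - P) * (d1 + a1) = P * (d2 + a2) -> (1 - P) * (d1 + b1) = P * (d2 + b2) ->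
  first_order al w d1 d2 a1 a2 -> first_order al w d1 d2 b1 b2 ->
  a1 = b1 /\ a2 = b2.
Proof.
move=> /andP[P_gt0 P_lt1] a10 a20 b10 b20 Ea Eb [fa _] [fb _].
have Q_gt0 : 0 < 1 - P by lra.
have E : (1 - P) * (a1 - b1) = P * (a2 - b2) by lra.
have a1E : a1 = b1.
  apply/eqP; rewrite eq_le; apply/andP; split; rewrite leNgt; apply/negP => ab.
    have [a2E _] := fa (le_lt_trans b10 ab).
    have : 0 < (1 - P) * (a1 - b1) by rewrite mulr_gt0 // subr_gt0.
    by rewrite E a2E sub0r pmulr_rgt0 //; lra.
  have [b2E _] := fb (le_lt_trans a10 ab).
  have : 0 < (1 - P) * (b1 - a1) by rewrite mulr_gt0 // subr_gt0.
  have : 0 <= P * a2 by rewrite mulr_ge0 // ltW.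
  by rewrite b2E subr0 in E; lra.
split=> //; move: E; rewrite a1E subrr mulr0 => /esym/eqP.
by rewrite mulf_eq0 gt_eqF //= subr_eq0 => /eqP.
Qed.

(** Positive, zero or negative according to whether the odds [P / (1 - P)] are
    above, equal to or below the odds after the best response to [(d1, d2)].
    Those are [d1 / d2] moved up to the smaller of
    [sqrt (al * d1 / ((1 - al) * d2))] and [(d1 + w) / d2] if this exceeds
    [d1 / d2], or moved down to the larger of
    [sqrt ((1 - be) * d1 / (be * d2))] (infinite for [be = 0]) and [d1 / (d2 + w)]
    if this is below it.
    Subtracting a minimum or maximum of odds turns it into a maximum or minimum of
    differences, and each difference is replaced by one of the same sign that is
    a polynomial in [P], [d1] and [d2]. *)
Definition excess al be w P d1 d2 : K :=
  let gap := P * d2 - (1 - P) * d1 in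
  Num.max
    (Num.min gap (Num.max (gap - (1 - P) * w)
                    ((1 - al) * P ^+ 2 * d2 - al * (1 - P) ^+ 2 * d1)))
    (Num.min (gap + P * w)
             (be * P ^+ 2 * d2 - (1 - be) * (1 - P) ^+ 2 * d1)).

(** A total [x] on the first outcome against [d2] on the second results in the
    price [P]; this translates the marginal quantity from wagers to prices. *)
Lemma first_order_sign al d1 d2 x P : 0 < d2 -> P < 1 -> (1 - P) * x = P * d2 ->
  ((1 - al) * x ^+ 2 <= al * d1 * d2) =
    ((1 - al) * P ^+ 2 * d2 - al * (1 - P) ^+ 2 * d1 <= 0) /\
  (al * d1 * d2 <= (1 - al) * x ^+ 2) =
    (0 <= (1 - al) * P ^+ 2 * d2 - al * (1 - P) ^+ 2 * d1).
Proof.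
move=> d2_gt0 P_lt1 xE; have Q2 : 0 < (1 - P) ^+ 2 by rewrite exprn_gt0 ?subr_gt0.
have E : d2 * ((1 - al) * P ^+ 2 * d2 - al * (1 - P) ^+ 2 * d1) =
         (1 - P) ^+ 2 * ((1 - al) * x ^+ 2 - al * d1 * d2).
  transitivity ((1 - al) * (P * d2) ^+ 2 - al * d1 * d2 * (1 - P) ^+ 2).
    by ring.
  by rewrite -xE; ring.
split.
  by rewrite -[RHS](pmulr_rle0 _ d2_gt0) E pmulr_rle0 // subr_le0.
by rewrite -[RHS](pmulr_rge0 _ d2_gt0) E pmulr_rge0 // subr_ge0.
Qed.

Lemma minr_eq0 x y : Num.min x y = 0 -> [/\ 0 <= x, 0 <= y & x = 0 \/ y = 0].
Proof. by rewrite /Num.min; case: ifPn => xy E; split; lra. Qed.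

Lemma maxr_eq0 x y : Num.max x y = 0 -> [/\ x <= 0, y <= 0 & x = 0 \/ y = 0].
Proof. by rewrite /Num.max; case: ifPn => xy E; split; lra. Qed.

(** The sign of the gap [P * d2 - (1 - P) * d1] tells which outcome the atomic
    player must back to bring the price to [P], and by how much.  The branch of
    [excess] for the other outcome cannot vanish, because profitable margins on
    both sides are incompatible with [al + be < 1]. *)
Lemma excess0_first_order al be w P d1 d2 :
  0 <= al -> 0 <= be -> al + be < 1 -> 0 < w -> 0 < d1 -> 0 < d2 ->
  0 < P < 1 -> excess al be w P d1 d2 = 0 ->
  exists a1 a2, [/\ [/\ 0 <= a1, 0 <= a2 & a1 + a2 <= w],
    (1 - P) * (d1 + a1) = P * (d2 + a2),
    first_order al w d1 d2 a1 a2 & first_order be w d2 d1 a2 a1].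
Proof.
move=> al0 be0 albe w_gt0 d1_gt0 d2_gt0 /andP[P_gt0 P_lt1].
rewrite /excess; set gap := P * d2 - _.
set B1 := (1 - al) * P ^+ 2 * d2 - _; set B2 := be * P ^+ 2 * d2 - _.
have B12 : B1 <= 0 -> B2 < 0.
  rewrite /B1 /B2 => B1_le0.
  have be1 : 0 <= 1 - be by lra.
  have h : 0 < (1 - al - be) * ((1 - P) ^+ 2 * d1).
    by rewrite !mulr_gt0 ?exprn_gt0 //; lra.
  have al1 : 0 < 1 - al by lra.
  rewrite -(pmulr_rlt0 _ al1).
  by have := ler_wpM2l be0 B1_le0; lra.
have Q_gt0 : 0 < 1 - P by lra.
have QwE : 0 < (1 - P) * w by rewrite mulr_gt0.
have PwE : 0 < P * w by rewrite mulr_gt0.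
move=> /maxr_eq0[M_le0 N_le0 MN]; case: (ltgtP gap 0) => gapS.
- have [gapw B2_ge0 tight] :
      [/\ 0 <= gap + P * w, 0 <= B2 & gap + P * w = 0 \/ B2 = 0].
    apply: minr_eq0; case: MN => // M0.
    by have [] := minr_eq0 M0; lra.
  pose a2 := - gap / P.
  have a2_gt0 : 0 < a2 by rewrite divr_gt0 //; lra.
  have a2w : a2 <= w by rewrite ler_pdivrMr // mulrC; lra.
  have Pa2 : P * a2 = - gap by rewrite mulrC divfK // gt_eqF.
  have yE : (1 - (1 - P)) * (d2 + a2) = (1 - P) * d1 by rewrite /gap in Pa2; lra.
  have P1 : 1 - P < 1 by lra.
  have [S1 S2] := @first_order_sign be d2 d1 _ _ d1_gt0 P1 yE.
  exists 0, a2; split; [by split; lra|lra|split; lra|].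
  have B2E : (1 - be) * (1 - P) ^+ 2 * d1 - be * (1 - (1 - P)) ^+ 2 * d2 = - B2.
    by rewrite /B2; ring.
  rewrite B2E in S1 S2.
  split=> [_|_ a2_lt]; first by split=> //; rewrite S1; lra.
  rewrite S2; case: tight => [gapE|->]; last lra.
  by have := ltr_pM2l P_gt0 a2 w; rewrite a2_lt Pa2; lra.
- have [gapw B1_le0 tight] :
      [/\ gap - (1 - P) * w <= 0, B1 <= 0 & gap - (1 - P) * w = 0 \/ B1 = 0].
    apply: maxr_eq0; case: MN => [M0|N0].
      by have [_ _ []] := minr_eq0 M0; lra.
    have [_ B2_ge0 _] := minr_eq0 N0.
    have B1_gt0 : 0 < B1.
      by rewrite ltNge; apply/negP => /B12; rewrite ltNge B2_ge0.
    by move: M_le0; rewrite ge_min ge_max; lra.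
  pose a1 := gap / (1 - P).
  have a1_gt0 : 0 < a1 by rewrite divr_gt0.
  have a1w : a1 <= w by rewrite ler_pdivrMr // mulrC; lra.
  have Pa1 : (1 - P) * a1 = gap by rewrite mulrC divfK // gt_eqF.
  have xE : (1 - P) * (d1 + a1) = P * d2 by rewrite /gap in Pa1; lra.
  have [S1 S2] := @first_order_sign al d1 d2 _ _ d2_gt0 P_lt1 xE.
  exists a1, 0; split; [by split; lra|lra| |split; lra].
  split=> [_|_ a1_lt]; first by split=> //; rewrite S1.
  rewrite S2 -/B1; case: tight => [gapE|->]; last lra.
  by have := ltr_pM2l Q_gt0 a1 w; rewrite a1_lt Pa1; lra.
have B2_le0 : B2 <= 0 by move: N_le0; rewrite ge_min; lra.
have B1_ge0 : 0 <= B1.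
  rewrite leNgt; apply/negP => B1_lt0; have B2_lt0 := B12 (ltW B1_lt0).
  case: MN => [/minr_eq0[_ + _]|/minr_eq0[]]; last lra.
  by rewrite le_max; lra.
exists 0, 0; rewrite !addr0; split; [by split; lra|rewrite /gap in gapS; lra| |].
  split=> [|_ _]; [lra|rewrite addr0].
  have [|_ ->] := @first_order_sign al d1 d2 d1 P d2_gt0 P_lt1 => //.
  by rewrite /gap in gapS; lra.
split=> [|_ _]; [lra|rewrite addr0].
have [|_ ->] := @first_order_sign be d2 d1 d2 (1 - P) d1_gt0 ltac:(lra).
  by rewrite /gap in gapS; lra.
by rewrite /B2 in B2_le0; lra.
Qed.

End Atomic.

(** * The distribution of beliefs *)

(** A continuous positive density on a compact interval has positive lower and
    finite upper bounds, so the measure is comparable with Lebesgue measure. *)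
Lemma density_bounds {R : realType}
    {mu : {measure set (measurableTypeR R) -> \bar R}} :
  has_continuous_positive_density mu ->
  exists m M : R, 0 < m /\ 
    forall A : set (measurableTypeR R), measurable A ->
    (m%:E * lebesgue_measure (A `&` `[0%R, 1%R]) <= mu A /\
     mu A <= M%:E * lebesgue_measure (A `&` `[0%R, 1%R]))%E.
Proof.
move=> [rho [rho_cont rho_gt0 muE]].
have [xm xm01 rho_min] := EVT_min ler01 rho_cont.
have [xM xM01 rho_max] := EVT_max ler01 rho_cont.
exists (rho xm), (rho xM); split=> [|A mA]; first exact: rho_gt0.
have mAI : measurable (A `&` `[0%R, 1%R] : set (measurableTypeR R)).
  exact: measurableI.
have mrho : measurable_fun (A `&` `[0%R, 1%R] : set (measurableTypeR R)) rho.
  have : measurable_fun (`[0%R, 1%R] : set (measurableTypeR R)) rho.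
    exact: subspace_continuous_measurable_fun.
  by apply: measurable_funS.
have mErho : measurable_fun (A `&` `[0%R, 1%R] : set (measurableTypeR R))
    (fun x => (rho x)%:E) by exact/measurable_EFinP.
rewrite muE // -!integral_cst //.
by split; apply: ge0_le_integral => // x [_ x01]; rewrite lee_fin;
  do ?[exact: rho_min | exact: rho_max | exact/ltW/rho_gt0].
Qed.

Section CDF.
Context {R : realType}.
Context (mu : {finite_measure set (measurableTypeR R) -> \bar R}).
Context (hmu : has_continuous_positive_density mu).

Definition cumul (u : R) : R := fine (mu `]-oo, u]%classic).

Lemma finite_measure_fin (A : set (measurableTypeR R)) :
  measurable A -> mu A \is a fin_num.
Proof. by move=> mA; apply: fin_num_measure. Qed.

Lemma cumulB (u v : R) : u <= v -> mu `]u, v]%classic = (cumul v - cumul u)%:E.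
Proof.
move=> uv; have -> : `]u, v]%classic = `]-oo, v] `\` `]-oo, u] :> set R.
  apply/seteqP; split=> x /=; rewrite !in_itv /=.
    by move=> /andP[ux ->]; split=> //; apply/negP; rewrite -ltNge.
  by move=> [-> /negP]; rewrite -ltNge => ->.
rewrite measureD //; last by rewrite ltey_eq finite_measure_fin.
rewrite setIidr; last by move=> x /=; rewrite !in_itv /= => /le_trans; apply.
by rewrite EFinB /cumul !fineK // finite_measure_fin.
Qed.

Lemma atomless (x : R) : mu [set x] = 0%E.
Proof.
have [m [M [m0 bounds]]] := density_bounds hmu.
have [//|_ le0] := bounds [set x]; apply/eqP; rewrite eq_le measure_ge0 andbT.
apply: le_trans le0 _; suff -> : lebesgue_measure ([set x] `&` `[0, 1]) = 0%E.
  by rewrite mule0.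
by apply: (@subset_measure0 _ _ _ lebesgue_measure _ [set x]) => //;
  [exact: measurableI | exact: lebesgue_measure_set1].
Qed.

Lemma cumul_lt (u v : R) : 0 <= u -> u < v -> v <= 1 -> cumul u < cumul v.
Proof.
move=> u0 uv v1; rewrite -subr_gt0 -lte_fin -cumulB ?ltW //.
have [m [M [m0 bounds]]] := density_bounds hmu.
have [//|lower _] := bounds `]u, v]%classic; apply: lt_le_trans lower.
rewrite setIidl; last first.
  move=> x /=; rewrite !in_itv /= => /andP[/ltW ux xv].
  by rewrite (le_trans u0 ux) (le_trans xv v1).
by rewrite lebesgue_measure_itv /= lte_fin uv -EFinD -EFinM lte_fin mulr_gt0 ?subr_gt0.
Qed.

Lemma cumul_le (u v : R) : u <= v -> cumul u <= cumul v.
Proof. by move=> uv; rewrite -subr_ge0 -lee_fin -cumulB. Qed.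

Lemma cumul_disjoint (u v : R) : u <= v -> `]u, v] `&` `[0, 1] = set0 ->
  cumul u = cumul v.
Proof.
move=> uv dis; have [m [M [m0 bounds]]] := density_bounds hmu.
have [//|_ upper] := bounds `]u, v]%classic.
have /eqP := cumulB uv; rewrite eq_le => /andP[_ /le_trans/(_ upper)].
by rewrite dis measure0 mule0 lee_fin; have := cumul_le uv; lra.
Qed.

Lemma cumul_le0 (u : R) : u <= 0 -> cumul u = 0.
Proof.
move=> u0; rewrite /cumul.
have [m [M [m0 bounds]]] := density_bounds hmu.
have [//|_] := bounds `]-oo, u]%classic.
have -> : lebesgue_measure (`]-oo, u] `&` `[0, 1]) = 0%E.
  apply: (@subset_measure0 _ _ _ lebesgue_measure _ [set 0]) => //;
    [exact: measurableI | | exact: lebesgue_measure_set1].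
  move=> x /=; rewrite !in_itv /= => -[xu /andP[x0 _]].
  by apply/eqP; rewrite eq_le x0 (le_trans xu).
rewrite mule0 => mu_le0; suff -> : mu `]-oo, u]%classic = 0%E by [].
by apply/eqP; rewrite eq_le mu_le0 measure_ge0.
Qed.

Lemma cumul_ge1 (u : R) : 1 <= u -> cumul u = cumul 1.
Proof.
move=> u1; apply/esym/cumul_disjoint => //; apply/seteqP; split=> x //=.
by rewrite !in_itv /= => -[/andP[x1 _] /andP[_]]; rewrite leNgt x1.
Qed.

Lemma cumul_gt0 (u : R) : 0 < u -> 0 < cumul u.
Proof.
move=> u0; rewrite -(cumul_le0 (lexx 0)).
have [u1|/ltW u1] := leP u 1; first exact: cumul_lt.
by rewrite (cumul_ge1 u1); apply: cumul_lt.
Qed.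

Lemma cumul_lt1 (u : R) : u < 1 -> cumul u < cumul 1.
Proof.
move=> u1; have [u0|/ltW u0] := leP 0 u; first exact: cumul_lt.
by rewrite (cumul_le0 u0) cumul_gt0.
Qed.

(** The upper bound on the density makes the distribution function Lipschitz. *)
Lemma cumul_continuous : continuous cumul.
Proof.
have [m [M [m0 bounds]]] := density_bounds hmu.
have lip u v : u <= v -> cumul v - cumul u <= `|M| * (v - u).
  move=> uv; rewrite -lee_fin -cumulB //.
  have [//|_ upper] := bounds `]u, v]%classic; apply: (le_trans upper).
  apply: (@le_trans _ _ (`|M|%:E * lebesgue_measure (`]u, v] `&` `[0%R, 1%R]))%E).
    by rewrite lee_wpmul2r // lee_fin ler_norm.
  rewrite EFinM lee_wpmul2l // ?lee_fin //.
  have : (lebesgue_measure (`]u, v] `&` `[0%R, 1%R]) <= lebesgue_measure `]u, v])%E.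
    by apply: le_measure; rewrite ?inE //; do ?[exact: measurableI | exact: subIsetl].
  move=> /le_trans; apply; rewrite lebesgue_measure_itv /= lte_fin.
  by case: ltP => // _; rewrite lee_fin subr_ge0.
have lip2 x y : `|cumul x - cumul y| <= `|M| * `|x - y|.
  have [xy|/ltW xy] := leP x y.
    rewrite ler0_norm ?subr_le0 ?cumul_le // opprB.
    by rewrite [`|x - y|]ler0_norm ?subr_le0 // opprB lip.
  by rewrite ger0_norm ?subr_ge0 ?cumul_le // [`|x - y|]ger0_norm ?subr_ge0 // lip.
move=> x; apply/cvgrPdist_le => e e0.
have M1 : 0 < `|M| + 1 by rewrite ltr_wpDl.
near=> y; apply: (le_trans (lip2 _ _)).
have : `|x - y| <= e / (`|M| + 1).
  by near: y; apply: cvgr_dist_le; [exact: cvg_id | rewrite divr_gt0].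
rewrite ler_pdivlMr // mulrDr mulr1 mulrC => /(le_trans _); apply.
by rewrite lerDl.
Unshelve. all: by end_near. Qed.

End CDF.

(** * Optimality in the game *)

Lemma ereal_sup_attained {R : realType} T (B : set T) (g : T -> R) a : B a ->
  ((g a)%:E = ereal_sup [set (g b)%:E | b in B]) <->
  (forall b, B b -> g b <= g a).
Proof.
move=> Ba; split=> [E b Bb|H].
  by rewrite -lee_fin E; apply: ereal_sup_ubound; exists b.
apply/eqP; rewrite eq_le; apply/andP; split.
  by apply: ereal_sup_ubound; exists a.
by apply: ge_ereal_sup => _ [b Bb <-]; rewrite lee_fin H.
Qed.

Section Game.
Context {R : realType}.
Implicit Types (kappa w q P p r u v : R) (a b d : R * R).

(** If an outcome has total wager zero, then so is the bet on it: this is where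
    the indicator convention and the convention x / 0 = 0 agree. *)
Lemma profit_atomic_gain kappa q d b :
  0 <= d.1 -> 0 <= d.2 -> 0 <= b.1 -> 0 <= b.2 -> 0 < d.1 + b.1 + d.2 + b.2 ->
  profit kappa (implied_prob d b) q b =
  atomic_gain (kappa * q) (kappa * (1 - q)) d.1 d.2 b.1 b.2.
Proof.
case: d b => [d1 d2] [b1 b2] /= d10 d20 b10 b20 T_gt0.
rewrite /profit /implied_prob /atomic_gain /=.
set T := d1 + b1 + d2 + b2 in T_gt0 *.
have T_neq0 : T != 0 by rewrite gt_eqF.
have -> : 1 - (d1 + b1) / T = (d2 + b2) / T.
  by rewrite -[1](divff T_neq0) -mulrBl; congr (_ / _); rewrite /T; ring.
have -> : ((d1 + b1) / T != 1) = (d2 + b2 != 0).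
  rewrite -[X in _ != X](divff T_neq0) (inj_eq (mulIf _)) ?invr_eq0 //.
  by rewrite -subr_eq0 -[in RHS]oppr_eq0; congr (~~ (_ == _)); rewrite /T; ring.
have -> : ((d1 + b1) / T != 0) = (d1 + b1 != 0).
  by rewrite mulf_eq0 invr_eq0 (negPf T_neq0) orbF.
have fraction (c x y : R) : 0 <= y -> y <= x ->
    y * (kappa * (x != 0)%:R * c / (x / T) - 1) = kappa * c * (y / x) * T - y.
  move=> y0 yx; have [x0|x_neq0] := eqVneq x 0; last first.
      by rewrite /= mulr1; field; apply/andP.
  have -> : y = 0 by lra.
  by rewrite !mul0r mulr0 mul0r subr0.
by rewrite !fraction //; try lra.
Qed.

Lemma some_wager_gt0 d b : 0 <= d.1 -> 0 <= d.2 -> 0 <= b.1 -> 0 <= b.2 ->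
  some_wager d b <-> 0 < d.1 + b.1 + d.2 + b.2.
Proof.
move=> d10 d20 b10 b20; split=> [[]|T_gt0]; [lra..|].
rewrite /some_wager; case: (ltP 0 d.1) => ?; first by constructor 1.
case: (ltP 0 d.2) => ?; first by constructor 2.
case: (ltP 0 b.1) => ?; first by constructor 3.
by constructor 4; lra.
Qed.

Lemma atomic_optimumP kappa w q d a :
  0 <= d.1 -> 0 <= d.2 -> bets w a -> some_wager d a ->
  ((profit kappa (implied_prob d a) q a)%:E =
     ereal_sup [set (profit kappa (implied_prob d b) q b)%:E
               | b in [set b | bets w b /\ some_wager d b]]) <->
  best_response (kappa * q) (kappa * (1 - q)) w d.1 d.2 a.1 a.2.
Proof.
move=> d10 d20 [a10 a20 aw] wa; set B := [set b | _].
have Ba : B a by [].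
rewrite (ereal_sup_attained (fun b => profit kappa (implied_prob d b) q b) Ba).
split=> [opt|[_ _ _ opt] b [[b10 b20 bw] wb]].
  split=> // b1 b2 b10 b20 bw T_gt0; have := opt (b1, b2).
  rewrite !profit_atomic_gain //; last exact/some_wager_gt0.
  by apply; split=> //; apply/some_wager_gt0.
have T_gt0 := (some_wager_gt0 d10 d20 b10 b20).1 wb.
rewrite !profit_atomic_gain //; last exact/some_wager_gt0.
exact: opt.
Qed.

(** The tie-breaking at the two thresholds, here in favour of abstaining, only
    concerns a negligible set of beliefs. *)
Definition diffuse_choice kappa P p : R * R :=
  ((P < kappa * p)%R%:R, (1 - P < kappa * (1 - p))%R%:R).

Lemma profit_interior kappa P r b : 0 < P < 1 ->
  profit kappa P r b =
  b.1 * ((kappa * r - P) / P) + b.2 * ((kappa * (1 - r) - (1 - P)) / (1 - P)).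
Proof.
move=> /andP[P_gt0 P_lt1]; rewrite /profit.
have P_neq0 : P != 0 by lra.
have P_neq1 : P != 1 by lra.
have Q_neq0 : 1 - P != 0 by lra.
by rewrite P_neq0 P_neq1 /=; field; apply/andP.
Qed.

Lemma diffuse_choice_bets kappa P p : kappa < 1 -> bets 1 (diffuse_choice kappa P p).
Proof.
move=> k1; rewrite /diffuse_choice; split=> /=; [exact: ler0n..|].
by case: ltP => h1; case: ltP => h2 /=; lra.
Qed.

Lemma diffuse_choice_optimal kappa P p b : kappa < 1 -> 0 < P < 1 -> bets 1 b ->
  profit kappa P p b <= profit kappa P p (diffuse_choice kappa P p).
Proof.
move=> k1 P01 [b10 b20 b1]; rewrite !profit_interior //=.
have [P_gt0 Q_gt0] : 0 < P /\ 0 < 1 - P by lra.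
have gain_sign (x y c : R) : 0 <= c -> 0 < x -> y <= x -> c * ((y - x) / x) <= 0.
  by move=> c0 x_gt0 yx; rewrite mulr_ge0_le0 // pmulr_lle0 ?invr_gt0 // subr_le0.
have gain_ge0 (x y : R) : 0 < x -> x < y -> 0 <= (y - x) / x.
  by move=> x_gt0 xy; rewrite divr_ge0 ?subr_ge0 ?ltW.
case: ltP => h1; case: ltP => h2 /=; rewrite ?mul1r ?mul0r ?addr0 ?add0r; first lra.
- have := gain_sign _ _ _ b20 Q_gt0 h2.
  suff : b.1 * ((kappa * p - P) / P) <= (kappa * p - P) / P by lra.
  by rewrite ler_piMl ?gain_ge0 //; lra.
- have := gain_sign _ _ _ b10 P_gt0 h1.
  suff : b.2 * ((kappa * (1 - p) - (1 - P)) / (1 - P)) <=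
         (kappa * (1 - p) - (1 - P)) / (1 - P) by lra.
  by rewrite ler_piMl ?gain_ge0 //; lra.
by have := gain_sign _ _ _ b10 P_gt0 h1; have := gain_sign _ _ _ b20 Q_gt0 h2; lra.
Qed.

(** The profit is linear in the bet with nonzero slopes that are not both
    positive, so its maximum over the triangle is attained at a single vertex. *)
Lemma diffuse_choice_unique kappa P p x : kappa < 1 -> 0 < P < 1 ->
  kappa * p != P -> kappa * (1 - p) != 1 - P -> bets 1 x ->
  (forall b, bets 1 b -> profit kappa P p b <= profit kappa P p x) ->
  x = diffuse_choice kappa P p.
Proof.
case: x => x1 x2 k1 P01 ne1 ne2 [/= x10 x20 x1x2] opt.
have [P_gt0 Q_gt0] : 0 < P /\ 0 < 1 - P by lra.
have [opt1 opt2] : [/\ profit kappa P p (1, 0) <= profit kappa P p (x1, x2)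
                   & profit kappa P p (0, 1) <= profit kappa P p (x1, x2)].
  by split; apply: opt; split=> /=; lra.
have [opt3 opt4] : [/\ profit kappa P p (x1, 0) <= profit kappa P p (x1, x2)
                   & profit kappa P p (0, x2) <= profit kappa P p (x1, x2)].
  by split; apply: opt; split=> /=; lra.
move: opt1 opt2 opt3 opt4; rewrite !profit_interior //=.
set s := (_ / P); set t := (_ / (1 - P)).
have sS : (P < kappa * p) = (0 < s) by rewrite pmulr_lgt0 ?invr_gt0 // subr_gt0.
have tS : (1 - P < kappa * (1 - p)) = (0 < t).
  by rewrite pmulr_lgt0 ?invr_gt0 // subr_gt0.
have s_neq0 : s != 0.
  by rewrite /s mulf_neq0 ?invr_eq0 ?(gt_eqF P_gt0) // subr_eq0.
have t_neq0 : t != 0.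
  by rewrite /t mulf_neq0 ?invr_eq0 ?(gt_eqF Q_gt0) // subr_eq0.
have st : 0 < s -> t < 0.
  by rewrite -sS => ?; rewrite lt_neqAle t_neq0 leNgt -tS -leNgt; lra.
rewrite /diffuse_choice sS tS => opt1 opt2 opt3 opt4.
have vanish (c y : R) : 0 <= y -> c < 0 -> 0 <= y * c -> y = 0.
  by move=> y0 c0; rewrite nmulr_lge0 // => ?; lra.
case: ltP => s0.
  have t0 := st s0; rewrite ltNge (ltW t0) /=.
  have x2E : x2 = 0 by apply: (@vanish t) => //; lra.
  rewrite x2E in opt1; have : (1 - x1) * s <= 0 by lra.
  by rewrite pmulr_lle0 // x2E => ?; congr (_, _); lra.
have s_lt0 : s < 0 by lra.
have x1E : x1 = 0 by apply: (@vanish s) => //; lra.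
case: ltP => t0 /=.
  have : (1 - x2) * t <= 0 by rewrite x1E in opt2; lra.
  by rewrite pmulr_lle0 // x1E => ?; congr (_, _); lra.
have x2E : x2 = 0 by apply: (@vanish t) => //; lra.
by rewrite x1E x2E.
Qed.

(** At an extreme price one fraction vanishes by convention, and the other is at
    most [kappa], so that every bet loses money. *)
Lemma diffuse_abstains kappa P p x : 0 < kappa < 1 -> 0 <= p <= 1 ->
  P = 0 \/ P = 1 -> bets 1 x ->
  (forall b, bets 1 b -> profit kappa P p b <= profit kappa P p x) ->
  x = (0, 0).
Proof.
case: x => x1 x2 /andP[k0 k1] /andP[p0 p1] P01 [/= x10 x20 x1x2] opt.
have : profit kappa P p (0, 0) <= profit kappa P p (x1, x2).
  by apply: opt; split=> /=; lra.
have kp : kappa * p < 1 by apply: le_lt_trans k1; rewrite ler_piMr // ltW.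
have kp' : kappa * (1 - p) < 1.
  by apply: le_lt_trans k1; rewrite ler_piMr ?(ltW k0) //; lra.
have nonpos (y c : R) : 0 <= y -> c < 1 -> y * (c - 1) <= 0.
  by move=> y0 c1; rewrite mulr_ge0_le0 //; lra.
rewrite /profit /= !mul0r addr0; case: P01 => ->.
  rewrite eqxx subr0 eq_sym oner_eq0 /= !divr1 !mulr1.
  rewrite mulr0 !mul0r sub0r mulrN1.
  have := nonpos _ _ x20 kp'.
  move=> h1 h2; have x1E : x1 = 0 by lra.
  congr (_, _) => //; apply/eqP; rewrite eq_le x20 andbT.
  have : 0 <= x2 * (kappa * (1 - p) - 1) by lra.
  by rewrite nmulr_lge0 //; lra.
rewrite eqxx subrr oner_eq0 /= !mulr1 divr1 mulr0 !mul0r sub0r mulrN1.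
have := nonpos _ _ x10 kp.
move=> h1 h2; have x2E : x2 = 0 by lra.
congr (_, _) => //; apply/eqP; rewrite eq_le x10 andbT.
have : 0 <= x1 * (kappa * p - 1) by lra.
by rewrite nmulr_lge0 //; lra.
Qed.

End Game.

(** * Aggregate diffuse wagers *)

Section Totals.
Context {R : realType}.
Context (mu : {finite_measure set (measurableTypeR R) -> \bar R}).
Context (hmu : has_continuous_positive_density mu).
Implicit Types (kappa w q P p r u v : R) (a b d : R * R).

Lemma measure_supported (A : set (measurableTypeR R)) : measurable A ->
  mu (A `&` `[0, 1]) = mu A.
Proof.
case: hmu => rho [_ _ muE] mA; rewrite !muE //; last exact: measurableI.
by rewrite -setIA setIid.
Qed.

Lemma measure_above u : mu (`]u, +oo[ `&` `[0, 1]) = (cumul mu 1 - cumul mu u)%:E.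
Proof.
have -> : `]u, +oo[ `&` `[0, 1] = `]u, 1]%classic `&` `[0, 1] :> set R.
  apply/seteqP; split=> x /=; rewrite !in_itv /= ?andbT.
    by move=> [-> /andP[-> ->]].
  by move=> [/andP[-> _]].
rewrite measure_supported //; have [u1|u1] := leP u 1; first exact: cumulB.
rewrite (cumul_ge1 hmu (ltW u1)) subrr set_itv_ge ?measure0 //.
by rewrite bnd_simp -leNgt ltW.
Qed.

(** Open and closed half-lines have the same mass since points are negligible. *)
Lemma measure_below v : mu (`]-oo, v[ `&` `[0, 1]) = (cumul mu v)%:E.
Proof.
rewrite measure_supported // /cumul fineK ?finite_measure_fin //.
rewrite -(@setUitv1 _ _ _ _ true) // measureU0 //; exact: atomless.
Qed.

Definition diffuse_demand kappa P : R * R :=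
  (cumul mu 1 - cumul mu (P / kappa), cumul mu (1 - (1 - P) / kappa)).

Lemma ae_off_points (Q : R -> Prop) u v :
  (forall p, p \in `[0, 1] -> p != u -> p != v -> Q p) ->
  {ae mu, forall p, p \in `[0%R, 1%R] -> Q p}.
Proof.
move=> H; apply: (@negligibleS _ _ _ mu ([set u] `|` [set v])).
  move=> p /=; apply: contra_notP => /not_orP[pu pv] p01.
  by apply: H => //; apply/eqP.
by apply: negligibleU; apply/negligibleP => //; exact: atomless.
Qed.

Lemma diffuse_choiceE kappa P p : 0 < kappa ->
  diffuse_choice kappa P p =
  (\1_(`]P / kappa, +oo[%classic : set R) p,
   \1_(`]-oo, 1 - (1 - P) / kappa[%classic : set R) p).
Proof.
move=> k0; rewrite /diffuse_choice !indicE; congr (_%:R, _%:R).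
  rewrite mem_setE.
  by rewrite in_itv /= andbT ltr_pdivrMr // mulrC.
rewrite mem_setE in_itv /=.
by rewrite ltrBrDl -ltrBrDr ltr_pdivrMr // mulrC.
Qed.

Lemma diffuse_choice_measurable kappa P (D : set (measurableTypeR R)) :
  0 < kappa -> measurable_fun D (diffuse_choice kappa P).
Proof.
move=> k0; rewrite (funext (fun p => diffuse_choiceE P p k0)).
apply: measurable_funTS.
by apply: measurable_fun_pair; exact: measurable_indic.
Qed.

Lemma Rintegral_ae_indic (A : set (measurableTypeR R)) (g : R -> R) :
  measurable A -> measurable_fun (`[0, 1] : set (measurableTypeR R)) g ->
  {ae mu, forall p, p \in `[0%R, 1%R] -> g p = \1_A p} ->
  \int[mu]_(p in `[0, 1]) g p = fine (mu (A `&` `[0, 1])).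
Proof.
move=> mA mg gE; rewrite /Rintegral -integral_indic //; congr fine.
apply: ae_eq_integral => //.
- exact/measurable_EFinP.
- by apply/measurable_EFinP; exact: measurable_indic.
- by apply: negligibleS gE => p; apply: contra_not => H p01; rewrite H.
Qed.

Lemma diffuse_totalE kappa P (f : R -> R * R) : 0 < kappa ->
  measurable_fun (`[0, 1] : set (measurableTypeR R)) f ->
  {ae mu, forall p, p \in `[0%R, 1%R] -> f p = diffuse_choice kappa P p} ->
  diffuse_total mu f = diffuse_demand kappa P.
Proof.
move=> k0 mf fE; rewrite /diffuse_total /diffuse_demand; congr (_, _).
  rewrite (@Rintegral_ae_indic `]P / kappa, +oo[%classic) ?measure_above //.
    exact: (measurableT_comp measurable_fst mf).
  by apply: negligibleS fE => p; apply: contra_not => H p01; rewrite H ?diffuse_choiceE.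
rewrite (@Rintegral_ae_indic `]-oo, 1 - (1 - P) / kappa[%classic) ?measure_below //.
  exact: (measurableT_comp measurable_snd mf).
by apply: negligibleS fE => p; apply: contra_not => H p01; rewrite H ?diffuse_choiceE.
Qed.

End Totals.

(** * Equilibria and prices *)

Section Equilibrium.
Context {R : realType}.
Context (mu : {finite_measure set (measurableTypeR R) -> \bar R}).
Context (kappa w q : R).
Context (hmu : has_continuous_positive_density mu).
Context (hkappa : 0 < kappa < 1).
Context (hw : 0 < w).
Context (hq : 0 <= q <= 1).
Implicit Types (P p r u v : R) (a b d : R * R) (f : R -> R * R).

Let kappa_gt0 : 0 < kappa. Proof. by case/andP: hkappa. Qed.
Let kappa_lt1 : kappa < 1. Proof. by case/andP: hkappa. Qed.
Let stake1_ge0 : 0 <= kappa * q.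
Proof. by case/andP: hq => q0 _; rewrite mulr_ge0 // ltW. Qed.
Let stake2_ge0 : 0 <= kappa * (1 - q).
Proof. by case/andP: hq => _ q1; rewrite mulr_ge0 ?subr_ge0 // ltW. Qed.
Let stakes_lt1 : kappa * q + kappa * (1 - q) < 1.
Proof. by rewrite -mulrDr subrKC mulr1. Qed.

(** The finite-dimensional core of an equilibrium: the diffuse players enter
    through their demand at [P] only, the atomic player through the marginal
    conditions, and the fourth condition says that [P] is the implied price. *)
Definition equilibrium_price P a : Prop :=
  let d := diffuse_demand mu kappa P in
  [/\ 0 < P < 1, 0 < d.1 /\ 0 < d.2, bets w a,
      (1 - P) * (d.1 + a.1) = P * (d.2 + a.2) &
      first_order (kappa * q) w d.1 d.2 a.1 a.2 /\
      first_order (kappa * (1 - q)) w d.2 d.1 a.2 a.1].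

Lemma diffuse_total_ge0 f a : feasible w f a ->
  0 <= (diffuse_total mu f).1 /\ 0 <= (diffuse_total mu f).2.
Proof.
by move=> [_ fb _]; split; apply: Rintegral_ge0 => p /fb[].
Qed.

Lemma nash_best_response f a : nash_equilibrium kappa w q mu f a ->
  best_response (kappa * q) (kappa * (1 - q)) w
    (diffuse_total mu f).1 (diffuse_total mu f).2 a.1 a.2.
Proof.
move=> [fa wa _ atomic]; have [d10 d20] := diffuse_total_ge0 fa.
by case: fa => _ _ ab; apply/(atomic_optimumP kappa q d10 d20 ab wa).
Qed.

Lemma nash_diffuse_optimal f a p b : nash_equilibrium kappa w q mu f a ->
  p \in `[0, 1] -> bets 1 b ->
  profit kappa (implied_prob (diffuse_total mu f) a) p b <=
  profit kappa (implied_prob (diffuse_total mu f) a) p (f p).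
Proof.
move=> [[_ fb _] _ diffuse _] p01.
exact: ((ereal_sup_attained _ (fb p p01)).1 (diffuse p p01)).
Qed.

Lemma nash_corner_abstain f a : nash_equilibrium kappa w q mu f a ->
  let P := implied_prob (diffuse_total mu f) a in
  P = 0 \/ P = 1 -> diffuse_total mu f = (0, 0).
Proof.
move=> ne P P01.
have f0 p : p \in `[0, 1] -> f p = (0, 0).
  move=> p01; have [[_ fb _] _ _ _] := ne.
  apply: (@diffuse_abstains _ kappa P p _ hkappa _ P01 (fb p p01)).
    by move: p01; rewrite in_itv /=.
  by move=> b b1; exact: nash_diffuse_optimal.
rewrite /diffuse_total; congr (_, _); rewrite /Rintegral integral0_eq // => p p01.
  by rewrite f0.
by rewrite f0.
Qed.

(** If nobody wagered on an outcome, the price would be extreme and all diffuse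
    players would abstain; the atomic player would then be alone and bet nothing
    either, against the requirement that some wager is placed.  So both outcomes
    are backed, and by diffuse players, as an uncontested atomic bet is never
    optimal. *)
Lemma nash_wagered f a : nash_equilibrium kappa w q mu f a ->
  let d := diffuse_total mu f in 0 < d.1 /\ 0 < d.2.
Proof.
move=> ne d; have br := nash_best_response ne.
have corner := nash_corner_abstain ne.
have [fa wa _ _] := ne; have [d10 d20] := diffuse_total_ge0 fa.
rewrite -/d in br corner wa d10 d20.
have [a10 a20 _ _] := br.
have stakeC : kappa * (1 - q) + kappa * q < 1 by rewrite addrC.
have no1 : d.1 = 0 -> a.1 = 0.
  move=> d1E; rewrite d1E in br.
  exact: (best_response_uncontested stake1_ge0 stake2_ge0 stakes_lt1 d20 br).
have no2 : d.2 = 0 -> a.2 = 0.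
  move=> d2E; rewrite d2E in br; have br' := best_responseC br.
  exact: (best_response_uncontested stake2_ge0 stake1_ge0 stakeC d10 br').
have T_gt0 := (some_wager_gt0 d10 d20 a10 a20).1 wa.
have abstain_absurd : d = (0, 0) -> False.
  by move=> dE; rewrite dE /= in no1 no2 T_gt0; rewrite no1 ?no2 in T_gt0 => //; lra.
split; rewrite lt0r ?d10 ?d20 andbT; apply/eqP => dE;
  apply: abstain_absurd; apply: corner.
  by left; rewrite /implied_prob dE no1 // addr0 mul0r.
right; rewrite /implied_prob -[X in _ / X]addrA dE no2 // !addr0 divff //.
by rewrite dE no2 // in T_gt0; lra.
Qed.

Lemma diffuse_choice_ae P f : 0 < P < 1 ->
  (forall p, p \in `[0, 1] -> bets 1 (f p)) ->
  (forall p b, p \in `[0, 1] -> bets 1 b ->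
     profit kappa P p b <= profit kappa P p (f p)) ->
  {ae mu, forall p, p \in `[0%R, 1%R] -> f p = diffuse_choice kappa P p}.
Proof.
move=> P01 fb opt.
apply: (ae_off_points hmu (u := P / kappa) (v := 1 - (1 - P) / kappa)).
move=> p p01 pu pv; apply: (diffuse_choice_unique kappa_lt1 P01) => //.
- by apply: contra_neq pu => <-; rewrite mulrAC divff ?mul1r // gt_eqF.
- apply: contra_neq pv => <-; rewrite mulrAC divff ?mul1r ?gt_eqF //.
  by rewrite opprB subrKC.
- exact: fb.
- by move=> b; exact: opt.
Qed.

Lemma nash_equilibrium_price f a : nash_equilibrium kappa w q mu f a ->
  exists2 P, equilibrium_price P a &
    {ae mu, forall p, p \in `[0%R, 1%R] -> f p = diffuse_choice kappa P p}.
Proof.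
move=> ne; have [d1_gt0 d2_gt0] := nash_wagered ne.
have br := nash_best_response ne.
have opt := nash_diffuse_optimal ne.
have [[mf fb ab] wa _ _] := ne.
set d := diffuse_total mu f in d1_gt0 d2_gt0 br opt wa *.
have [a10 a20 _ _] := br.
have T_gt0 : 0 < d.1 + a.1 + d.2 + a.2 by lra.
pose P := implied_prob d a.
have PT : P * (d.1 + a.1 + d.2 + a.2) = d.1 + a.1 by rewrite divfK // gt_eqF.
have P_gt0 : 0 < P by rewrite divr_gt0 //; lra.
have P_lt1 : P < 1 by rewrite ltr_pdivrMr // mul1r; lra.
have P01 : 0 < P < 1 by rewrite P_gt0.
have fE : {ae mu, forall p, p \in `[0%R, 1%R] -> f p = diffuse_choice kappa P p}.
  by apply: diffuse_choice_ae => // p b p01 b1; exact: opt.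
have dE : d = diffuse_demand mu kappa P by exact: diffuse_totalE.
exists P => //; rewrite /equilibrium_price -dE; split=> //; first lra.
have stakeC : kappa * (1 - q) + kappa * q < 1 by rewrite addrC.
have stake1_le1 : kappa * q <= 1 by move: stakes_lt1 stake2_ge0; lra.
have stake2_le1 : kappa * (1 - q) <= 1 by move: stakes_lt1 stake1_ge0; lra.
by split; [apply: best_response_first_order br
          | apply: best_response_first_order (best_responseC br)].
Qed.

Lemma equilibrium_price_nash P a : equilibrium_price P a ->
  nash_equilibrium kappa w q mu (diffuse_choice kappa P) a.
Proof.
rewrite /equilibrium_price => -[P01 [d1_gt0 d2_gt0] ab balance [fo1 fo2]].
have mf : measurable_fun (`[0, 1] : set (measurableTypeR R))
    (diffuse_choice kappa P) by exact: diffuse_choice_measurable.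
have dE : diffuse_total mu (diffuse_choice kappa P) = diffuse_demand mu kappa P.
  apply: diffuse_totalE => //; exact: (ae_off_points hmu (u := 0) (v := 0)).
set d := diffuse_demand mu kappa P in dE d1_gt0 d2_gt0 balance fo1 fo2.
have [a10 a20 aw] := ab; have [P_gt0 P_lt1] := andP P01.
have T_gt0 : 0 < d.1 + a.1 + d.2 + a.2 by lra.
have PE : implied_prob d a = P.
  apply: (mulIf (lt0r_neq0 T_gt0)); rewrite divfK ?gt_eqF //; lra.
have wa : some_wager d a by apply/some_wager_gt0; lra.
have fb p : bets 1 (diffuse_choice kappa P p) by exact: diffuse_choice_bets.
rewrite /nash_equilibrium dE; split=> //.
- rewrite PE => p p01; apply/(ereal_sup_attained (profit kappa P p) (fb p)) => b b1.
  exact: diffuse_choice_optimal.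
apply/atomic_optimumP => //; try exact: ltW.
by apply: first_order_best_response.
Qed.

(** Demand for the first outcome vanishes at prices from [kappa] on, demand for
    the second at prices up to [1 - kappa]. *)
Lemma equilibrium_price_kappa P a : equilibrium_price P a -> 1 / 2 < kappa.
Proof.
move=> [P01 [/= d1_gt0 d2_gt0] _ _ _].
have : P / kappa < 1.
  by rewrite ltNge; apply/negP => /(cumul_ge1 hmu) E; rewrite E subrr ltxx in d1_gt0.
have : 0 < 1 - (1 - P) / kappa.
  by rewrite ltNge; apply/negP => /(cumul_le0 hmu) E; rewrite E ltxx in d2_gt0.
by rewrite subr_gt0 !ltr_pdivrMr // !mul1r; lra.
Qed.

Lemma diffuse_demand_mono P P' : P <= P' ->
  (diffuse_demand mu kappa P').1 <= (diffuse_demand mu kappa P).1 /\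
  (diffuse_demand mu kappa P).2 <= (diffuse_demand mu kappa P').2.
Proof.
move=> PP'; have h : P / kappa <= P' / kappa by rewrite ler_pM2r ?invr_gt0.
split; first by rewrite lerB // cumul_le.
by apply: cumul_le; rewrite !mulrBl; lra.
Qed.

(** If [P < P'], passing from [P] to [P'] lowers [d1] and raises [d2], so that the
    odds could not increase. *)
Lemma equilibrium_price_le P P' a a' :
  equilibrium_price P a -> equilibrium_price P' a' -> P' <= P.
Proof.
move=> [P01 [d1_gt0 d2_gt0] [a10 a20 aw] balance [fo1 fo2]].
move=> [P'01 [e1_gt0 e2_gt0] [b10 b20 bw] balance' [fo1' fo2']].
rewrite leNgt; apply/negP => PP'.
have [ed1 de2] := diffuse_demand_mono (ltW PP').
have := odds_monotone stake1_ge0 stake2_ge0 stakes_lt1 d1_gt0 d2_gt0 e1_gt0 e2_gt0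
  ed1 de2 a10 a20 aw b10 b20 bw fo1 fo2 fo1' fo2'.
set x := _ + a.1 in balance *; set y := _ + a.2 in balance *.
set X := _ + a'.1 in balance' *; set Y := _ + a'.2 in balance' *.
have y_gt0 : 0 < y by rewrite /y; lra.
have Y_gt0 : 0 < Y by rewrite /Y; lra.
move: P01 P'01 => /andP[P_gt0 P_lt1] /andP[P'_gt0 P'_lt1] odds.
have c_gt0 : 0 < (1 - P) * (1 - P') by rewrite mulr_gt0 ?subr_gt0.
have yY : 0 < y * Y by rewrite mulr_gt0.
have E' : (1 - P) * (1 - P') * (X * y) = P' * (1 - P) * (y * Y).
  by transitivity ((1 - P') * X * ((1 - P) * y)); [ring | rewrite balance'; ring].
have E : (1 - P) * (1 - P') * (x * Y) = P * (1 - P') * (y * Y).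
  by transitivity ((1 - P) * x * ((1 - P') * Y)); [ring | rewrite balance; ring].
by move: odds; rewrite -(ler_pM2l c_gt0) E E' ler_pM2r //; lra.
Qed.

Lemma equilibrium_price_unique P P' a a' :
  equilibrium_price P a -> equilibrium_price P' a' -> P = P' /\ a = a'.
Proof.
move=> eq eq'; have PP' : P = P'.
  by apply/eqP; rewrite eq_le (equilibrium_price_le eq eq') (equilibrium_price_le eq' eq).
split=> //; rewrite -PP' in eq'.
case: a a' eq eq' => [a1 a2] [b1 b2].
move=> [P01 _ [a10 a20 _] Ea [fa _]] [_ _ [b10 b20 _] Eb [fb _]].
by have [/= -> ->] := first_order_unique P01 a10 a20 b10 b20 Ea Eb fa fb.
Qed.

Definition price_excess P : R :=
  excess (kappa * q) (kappa * (1 - q)) w P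
    (diffuse_demand mu kappa P).1 (diffuse_demand mu kappa P).2.

Lemma price_excess_continuous : continuous price_excess.
Proof.
pose cont (g : R -> R) := continuous g.
have cst (c : R) : cont (fun=> c) by move=> x; exact: cvg_cst.
have idc : cont id by move=> x; exact: cvg_id.
have add (g h : R -> R) : cont g -> cont h -> cont (fun x => g x + h x).
  by move=> cg ch x; apply: continuousD; [exact: cg | exact: ch].
have opp (g : R -> R) : cont g -> cont (fun x => - g x).
  by move=> cg x; apply: continuousN; exact: cg.
have mul (g h : R -> R) : cont g -> cont h -> cont (fun x => g x * h x).
  by move=> cg ch x; apply: continuousM; [exact: cg | exact: ch].
have sqr (g : R -> R) : cont g -> cont (fun x => g x ^+ 2).
  by move=> cg; exact: mul.
have max (g h : R -> R) : cont g -> cont h -> cont (fun x => Num.max (g x) (h x)).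
  by move=> cg ch x; apply: continuous_max; [exact: cg | exact: ch].
have min (g h : R -> R) : cont g -> cont h -> cont (fun x => Num.min (g x) (h x)).
  by move=> cg ch x; apply: continuous_min; [exact: cg | exact: ch].
have cumulc (g : R -> R) : cont g -> cont (fun x => cumul mu (g x)).
  by move=> cg x; apply: (@continuous_comp _ _ _ g (cumul mu));
    [exact: cg | exact: cumul_continuous].
have Qc : cont (fun P => 1 - P) := add _ _ (cst 1) (opp _ idc).
pose d1 P := (diffuse_demand mu kappa P).1.
pose d2 P := (diffuse_demand mu kappa P).2.
have d1c : cont d1 :=
  add _ _ (cst _) (opp _ (cumulc _ (mul _ _ idc (cst kappa^-1)))).
have d2c : cont d2 :=
  cumulc _ (add _ _ (cst 1) (opp _ (mul _ _ Qc (cst kappa^-1)))).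
have gapc : cont (fun P => P * d2 P - (1 - P) * d1 P) :=
  add _ _ (mul _ _ idc d2c) (opp _ (mul _ _ Qc d1c)).
have marginc s t : cont (fun P => s * P ^+ 2 * d2 P - t * (1 - P) ^+ 2 * d1 P) :=
  add _ _ (mul _ _ (mul _ _ (cst s) (sqr _ idc)) d2c)
    (opp _ (mul _ _ (mul _ _ (cst t) (sqr _ Qc)) d1c)).
exact: (max _ _
  (min _ _ gapc (max _ _ (add _ _ gapc (opp _ (mul _ _ Qc (cst w)))) (marginc _ _)))
  (min _ _ (add _ _ gapc (mul _ _ idc (cst w))) (marginc _ _))).
Qed.

(** At [P = 1 - kappa] no diffuse player backs the second outcome, and at
    [P = kappa] none backs the first; the excess has opposite signs there. *)
Lemma equilibrium_price_exists : 1 / 2 < kappa ->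
  exists P a, equilibrium_price P a.
Proof.
move=> k2.
have k12 : 1 - kappa <= kappa by lra.
have lo : price_excess (1 - kappa) < 0.
  rewrite /price_excess /excess /=.
  have -> : 1 - (1 - (1 - kappa)) / kappa = 0.
    by rewrite subKr divff ?subrr // gt_eqF.
  rewrite cumul_le0 // !subKr.
  have d_gt0 : 0 < cumul mu 1 - cumul mu ((1 - kappa) / kappa).
    by rewrite subr_gt0 cumul_lt1 // ltr_pdivrMr // mul1r; lra.
  rewrite gt_max !gt_min; set d := _ - cumul _ _ in d_gt0 *.
  have : 0 < kappa * d by rewrite mulr_gt0.
  have : 0 < (1 - kappa * (1 - q)) * (kappa ^+ 2 * d).
    by rewrite !mulr_gt0 ?exprn_gt0 //; move: stakes_lt1 stake1_ge0; lra.
  move=> h1 h2; apply/andP; split; first by apply/orP; left; lra.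
  by apply/orP; right; lra.
have hi : 0 < price_excess kappa.
  rewrite /price_excess /excess /=.
  rewrite divff ?gt_eqF // subrr.
  have d_gt0 : 0 < cumul mu (1 - (1 - kappa) / kappa).
    by rewrite cumul_gt0 // subr_gt0 ltr_pdivrMr // mul1r; lra.
  set d := cumul _ _ in d_gt0 *.
  rewrite lt_max !lt_min lt_max.
  have : 0 < kappa * d by rewrite mulr_gt0.
  have : 0 < (1 - kappa * q) * (kappa ^+ 2 * d).
    by rewrite !mulr_gt0 ?exprn_gt0 //; move: stakes_lt1 stake2_ge0; lra.
  move=> h1 h2; apply/orP; left; apply/andP; split; first lra.
  by apply/orP; right; lra.
have [P Pk ex0] : exists2 P : R, P \in `[1 - kappa, kappa] & price_excess P = 0.
  apply: IVT => //; last by rewrite ge_min le_max (ltW lo) (ltW hi) orbT.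
  by apply: continuous_subspaceT; exact: price_excess_continuous.
have PB : 1 - kappa < P < kappa.
  have P_lo : P != 1 - kappa by apply: contraTneq lo => <-; rewrite ex0 ltxx.
  have P_hi : P != kappa by apply: contraTneq hi => <-; rewrite ex0 ltxx.
  by move: Pk; rewrite in_itv /= !lt_neqAle P_hi eq_sym P_lo.
have [P_lo P_hi] := andP PB; have P01 : 0 < P < 1.
  by rewrite (lt_trans _ P_lo) ?subr_gt0 // (lt_trans P_hi).
have d1_gt0 : 0 < (diffuse_demand mu kappa P).1.
  by rewrite subr_gt0 cumul_lt1 // ltr_pdivrMr // mul1r; lra.
have d2_gt0 : 0 < (diffuse_demand mu kappa P).2.
  by rewrite cumul_gt0 // subr_gt0 ltr_pdivrMr // mul1r; lra.
have [a1 [a2 [ab balance fo1 fo2]]] := excess0_first_order stake1_ge0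
  stake2_ge0 stakes_lt1 hw d1_gt0 d2_gt0 P01 ex0.
by exists P, (a1, a2); split.
Qed.

End Equilibrium.

Unset Implicit Arguments.

Theorem theorem4p3 (R : realType) (kappa w q : R)
    (mu : {finite_measure set (measurableTypeR R) -> \bar R})
    (hkappa : 0 < kappa < 1) (hw : 0 < w) (hq : 0 <= q <= 1)
    (hmu : has_continuous_positive_density mu) :
  ((exists (f : R -> R * R) (a : R * R), nash_equilibrium kappa w q mu f a)
     <-> 1 / 2 < kappa) /\
  (forall (f g : R -> R * R) (a b : R * R),
     nash_equilibrium kappa w q mu f a ->
     nash_equilibrium kappa w q mu g b ->
     {ae mu, forall p, p \in `[0%R, 1%R] -> f p = g p} /\ a = b).
Proof.
split; first split=> [[f [a ne]]|k2].
- have [P price _] := nash_equilibrium_price hmu hkappa hq ne.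
  exact: (equilibrium_price_kappa hmu hkappa price).
- have [P [a price]] := equilibrium_price_exists hmu hkappa hw hq k2.
  exists (diffuse_choice kappa P), a.
  exact: (equilibrium_price_nash hmu hkappa hw hq price).
move=> f g a b nef neg.
have [P price_f fE] := nash_equilibrium_price hmu hkappa hq nef.
have [P' price_g gE] := nash_equilibrium_price hmu hkappa hq neg.
have [PP' ab] := equilibrium_price_unique hkappa hq price_f price_g.
split=> //; rewrite -PP' in gE.
apply: negligibleS (negligibleU fE gE) => p /= neq.
apply: contrapT => /not_orP[/contrapT fp /contrapT gp].
by apply: neq => p01; rewrite fp // gp.
Qed.
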